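(* Suppose (i) $P$ is either the graph property $D_n$ for some natural number $n\ge1$ or the graph property $C_m$ for some natural number $m\ge 2$, and (ii) $H$ is either the complete graph $K_\kappa$, or the Turán graph $T_{\kappa,k}$ for some infinite cardinal $\kappa$ and natural number $k\ge 2$, or the Cantor graph. Then Alice has a winning strategy in the game $\mathbb E_{H,P}$; i.e. $P$ is not elusive in $H$.
   Context: $D_n$: ''the degree of each vertex is at least $n$''. $C_m$: ''every connected component has size at least $m$''. For a cardinal $\kappa$ and $n\ge2$, the Turán graph $T_{\kappa,n}$ has vertex set $\kappa\times n$ and edges $\{\langle\alpha,i\rangle,\langle\beta,j\rangle\}$ for $\alpha,\beta\in\kappa$, $i\ne j<n$. The Cantor graph has as vertices all finite $0$-$1$ sequences, with $\{s,t\}$ an edge iff $s\subsetneq t$ or $t\subsetneq s$. (The complete graph $K_\kappa$ is taken with $\kappa$ an infinite cardinal.) For a graph $H=\langle V,E^*\rangle$, an $H$-pregraph is a triple $\langle V,E,N\rangle$ with $E\cup N\subseteq E^*$, $E\cap N=\emptyset$ (edges, nonedges; $E\cup N$ = determined pairs, the rest of $E^*$ undetermined). An $H$-graph $\langle V,E\rangle$ ($E\subseteq E^*$) extends $\langle V,E_0,N_0\rangle$ if $E_0\subseteq E$, $N_0\cap E=\emptyset$. Game $\mathbb E_{H,P}$: Alice and Bob build a transfinite sequence of $H$-pregraphs $G_\alpha$, $G_0=\langle V,\emptyset,\emptyset\rangle$, unions at limits; at a successor step Alice picks an undetermined pair and Bob declares it edge or nonedge. The game terminates at the first stage $\beta$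 at which either every $H$-graph extending $G_\beta$ has $P$ or none does. Bob wins iff at termination all pairs in $E^*$ are determined; otherwise Alice wins. $P$ is elusive in $H$ iff Alice has no winning strategy. *)

(* Defs.v *)
From Stdlib Require Import Relation_Operators.
From mathcomp Require Import all_boot all_classical.
From mathcomp Require Import wochoice.

Set Implicit Arguments.
Unset Strict Implicit.
Unset Printing Implicit Defensive.

Local Open Scope classical_set_scope.
Local Open Scope card_scope.

(* Edges are unordered pairs, i.e. two-element subsets of the vertex type. *)
Definition pairs (V : Type) : set (set V) :=
  [set e | exists x y : V, x <> y /\ e = [set x; y]].
Arguments pairs : clear implicits.

Record graph := Graph {
  vertex :> Type;
  edges : set (set vertex);
  edges_pairs : edges `<=` pairs vertex }.
Arguments edges : clear implicits.

Lemma rel_edges_pairs (V : Type) (r : V -> V -> Prop) :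
  [set e | exists x y : V, [/\ x <> y, r x y & e = [set x; y]]] `<=` pairs V.
Proof. by move=> e [x [y [xy _ ->]]]; exists x, y. Qed.

Definition graph_of_rel (V : Type) (r : V -> V -> Prop) : graph :=
  Graph (@rel_edges_pairs V r).

(* A cardinal is represented by an arbitrary type of that cardinality. *)
Definition complete_graph (K : Type) : graph :=
  graph_of_rel (fun _ _ : K => True).

Definition turan_graph (K : Type) (k : nat) : graph :=
  graph_of_rel (fun u v : K * 'I_k => u.2 <> v.2).

Definition proper_prefix (s t : seq bool) : bool := prefix s t && (s != t).

Definition cantor_graph : graph :=
  graph_of_rel (fun s t : seq bool => proper_prefix s t \/ proper_prefix t s).

Definition graph_property := graph -> Prop.

Definition adjacent (G : graph) (x y : G) : Prop := edges G [set x; y].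

Definition neighbours (G : graph) (x : G) : set G := [set y | adjacent x y].

Definition connected_in (G : graph) : G -> G -> Prop :=
  clos_refl_trans G (@adjacent G).

Definition is_component (G : graph) (C : set G) : Prop :=
  exists x : G, C = [set y | connected_in x y].

Definition min_degree_ge (n : nat) : graph_property :=
  fun G => forall x : G, `I_n #<= neighbours x.

Definition component_size_ge (m : nat) : graph_property :=
  fun G => forall C : set G, is_component C -> `I_m #<= C.

Record pregraph (H : graph) := Pregraph {
  pedges : set (set H);
  pnonedges : set (set H);
  pregraph_sub : pedges `|` pnonedges `<=` edges H;
  pregraph_disj : pedges `&` pnonedges = set0 }.

Definition determined (H : graph) (G : pregraph H) : set (set H) :=
  pedges G `|` pnonedges G.

Definition undetermined (H : graph) (G : pregraph H) : set (set H) :=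
  edges H `\` determined G.

Definition hgraph (H : graph) (E : set (set H)) (EH : E `<=` edges H) : graph :=
  Graph (subset_trans EH (@edges_pairs H)).

Definition extends (H : graph) (E : set (set H)) (G : pregraph H) : Prop :=
  pedges G `<=` E /\ pnonedges G `&` E = set0.

Definition terminal (H : graph) (P : graph_property) (G : pregraph H) : Prop :=
  (forall (E : set (set H)) (EH : E `<=` edges H),
     extends E G -> P (hgraph EH)) \/
  (forall (E : set (set H)) (EH : E `<=` edges H),
     extends E G -> ~ P (hgraph EH)).

(* Alice picks the undetermined pair e in G, and Bob's answer leads to G'. *)
Definition step (H : graph) (G : pregraph H) (e : set H) (G' : pregraph H) :
    Prop :=
  undetermined G e /\
  ((pedges G' = pedges G `|` [set e] /\ pnonedges G' = pnonedges G) \/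
   (pedges G' = pedges G /\ pnonedges G' = pnonedges G `|` [set e])).

Section Indices.
Variables (I : Type) (le : rel I).

Definition slt (i j : I) : Prop := le i j /\ i <> j.

Definition is_zero (i : I) : Prop := forall j, ~ slt j i.

Definition is_succ (j i : I) : Prop :=
  slt j i /\ forall k, ~ (slt j k /\ slt k i).

Definition is_limit (i : I) : Prop :=
  ~ is_zero i /\ forall j, ~ is_succ j i.

End Indices.

(* Ordinal-indexed sequences are rendered as families over a well-ordered type
   I. The game has been played up to stage b, the greatest element of I; the
   last clause says that it did not terminate before stage b. *)
Record is_play (H : graph) (P : graph_property) (I : Type) (le : rel I)
    (G : I -> pregraph H) (b : I) : Prop := IsPlay {
  play_wo : well_order le;
  play_last : forall i, le i b;
  play_zero : forall i, is_zero le i ->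
    pedges (G i) = set0 /\ pnonedges (G i) = set0;
  play_succ : forall j i, is_succ le j i -> exists e, step (G j) e (G i);
  play_limit : forall i, is_limit le i ->
    pedges (G i) = \bigcup_(j in [set j | slt le j i]) pedges (G j) /\
    pnonedges (G i) = \bigcup_(j in [set j | slt le j i]) pnonedges (G j);
  play_running : forall i, slt le i b -> ~ terminal P (G i) }.

(* The set of positions visited up to stage i. Positions strictly increase
   along a play, so this set, ordered by inclusion, determines the whole
   sequence up to stage i: nothing is lost with respect to the history. *)
Definition history (H : graph) (I : Type) (le : rel I) (G : I -> pregraph H)
    (i : I) : set (pregraph H) :=
  [set G j | j in [set j | le j i]].

Definition strategy (H : graph) := set (pregraph H) -> set H.

Definition follows (H : graph) (s : strategy H) (I : Type) (le : rel I)
    (G : I -> pregraph H) : Prop :=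
  forall j i, is_succ le j i -> step (G j) (s (history le G j)) (G i).

Definition bob_wins_at (H : graph) (G : pregraph H) : Prop :=
  determined G = edges H.

(* Alice must always have a legal move as long as the game is running, so that
   a strategy cannot win by getting stuck. *)
Definition winning (H : graph) (P : graph_property) (s : strategy H) : Prop :=
  forall (I : Type) (le : rel I) (G : I -> pregraph H) (b : I),
    is_play P le G b -> follows s le G ->
    (~ terminal P (G b) -> undetermined (G b) (s (history le G b))) /\
    (terminal P (G b) -> ~ bob_wins_at (G b)).

Definition alice_has_winning_strategy (H : graph) (P : graph_property) : Prop :=
  exists s : strategy H, winning P s.

Definition elusive (H : graph) (P : graph_property) : Prop :=
  ~ alice_has_winning_strategy H P.

(* Main.v *)
(** A strategy of Alice may be composed of successive rounds: in a round she
    either asks all pairs of some set, or probes a sequence of pairs [e 0],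
    [e 1], ... until the first positive answer. Call a vertex satisfied once its
    degree (resp. the size of its component) is large enough. Alice wins as soon
    as an undetermined pair joins two satisfied vertices, for she may then ask
    everything else; she also wins when some vertex can no longer be satisfied
    while a pair is undetermined.

    All the graphs [H] in question contain a biclique [l i] -- [r j] with
    countably infinite sides. Alice first leaves undetermined only pairs at a few
    centers, among them [l 0] and [r 0]. If infinitely many neighbours of [l 0]
    through undetermined pairs are satisfied, she probes these pairs: either
    [l 0] gets satisfied while one of them is left, or [l 0] is doomed while a
    pair at another center is left. The same holds for [r 0]. Otherwise Alice
    arranges that infinitely many unsatisfied vertices (resp. components) can only
    be saved through [l 0], and infinitely many others through [r 0]. Asking all
    pairs but the one joining [l 0] and [r 0] then forces Bob to satisfy both, and
    that last pair becomes irrelevant. *)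

Require Import Defs.
From Stdlib Require Import Relation_Operators.
From mathcomp Require Import all_boot all_classical.
From mathcomp Require Import wochoice zify.

Set Implicit Arguments.
Unset Strict Implicit.
Unset Printing Implicit Defensive.

Local Open Scope classical_set_scope.
Local Open Scope card_scope.

(** Totalizes a partial rule: where no value is suitable, [f] is unconstrained. Strategies can thus
    be defined on all arguments. *)
Lemma choose_some (A B : Type) (F : A -> set B) (b0 : B) :
  exists f, forall a b, F a b -> F a (f a).
Proof.
suff /choice[f fP] : forall a, exists c, forall b, F a b -> F a c by exists f.
move=> a; have [[b Fb]|nF] := pselect (exists b, F a b); first by exists b.
by exists b0 => b Fb; case: nF; exists b.
Qed.

(** * Well-orders and transfinite induction *)

Section WellOrder.
Variables (I : Type) (le : rel I).
Hypothesis le_wo : well_order le.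

Lemma wo_least (A : set I) : A !=set0 -> exists2 z, A z & forall x, A x -> le z x.
Proof.
move=> [x Ax]; have [|z [[zA zmin] _]] := le_wo (A := fun x => `[< A x >]).
  by exists x; apply/asboolP.
exists z; first exact/asboolP.
by move=> y Ay; apply: zmin; apply/asboolP.
Qed.

Lemma wo_refl i : le i i.
Proof. by have [|z -> h] := @wo_least [set i]; [exists i | exact: h]. Qed.

Lemma wo_total i j : le i j \/ le j i.
Proof.
have [|z [->|->] h] := @wo_least [set i; j]; first by exists i; left.
- by left; apply: h; right.
- by right; apply: h; left.
Qed.

(** Both [i] and [j] are minima of [[set i; j]], and [well_order] makes the minimum unique. *)
Lemma wo_anti i j : le i j -> le j i -> i = j.
Proof.
move=> ij ji; have [|z [_ zu]] := le_wo (A := fun x => `[< [set i; j] x >]).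
  by exists i; apply/asboolP; left.
have /zu <- : minimum_of le (fun x => `[< [set i; j] x >]) i.
  split; first by apply/asboolP; left.
  by move=> x /asboolP[->|->//]; exact: wo_refl.
apply: zu; split; first by apply/asboolP; right.
by move=> x /asboolP[->//|->]; exact: wo_refl.
Qed.

Lemma wo_trans i j k : le i j -> le j k -> le i k.
Proof.
move=> ij jk.
have [|z zijk h] := @wo_least [set x | [\/ x = i, x = j | x = k]].
  by exists i; constructor 1.
have zi : le z i by apply: h; constructor 1.
have zj : le z j by apply: h; constructor 2.
have zk : le z k by apply: h; constructor 3.
case: zijk zi zj zk => -> zi zj zk //.
- by rewrite (wo_anti ij zi).
- by rewrite -(wo_anti jk zj).
Qed.

Lemma wo_leNlt i j : ~ le i j -> slt le j i.
Proof.
move=> nij; have [//|ji] := wo_total i j; split=> // eqji.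
by apply: nij; rewrite eqji; exact: wo_refl.
Qed.

Lemma wo_ltNle i j : slt le i j -> ~ le j i.
Proof. by move=> [ij ne] ji; apply: ne; exact: wo_anti. Qed.

Lemma wo_le_lt_trans i j k : le i j -> slt le j k -> slt le i k.
Proof.
move=> ij [jk ne]; split; first exact: wo_trans jk.
by move=> ik; apply: ne; apply: wo_anti => //; rewrite -ik.
Qed.

Lemma wo_le_succ i j k : is_succ le j k -> slt le i k -> le i j.
Proof.
move=> [_ jk] ik; apply: contrapT => /wo_leNlt ji.
by apply: (jk i).
Qed.

Lemma wo_ind (Q : I -> Prop) :
  (forall i, (forall j, slt le j i -> Q j) -> Q i) -> forall i, Q i.
Proof.
move=> h i; apply: contrapT => nQi.
have [|z nQz zmin] := @wo_least [set x | ~ Q x]; first by exists i.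
apply: nQz; apply: h => j jz; apply: contrapT => nQj.
exact: (wo_ltNle jz (zmin _ nQj)).
Qed.

Lemma zero_succ_limit i :
  [\/ is_zero le i, exists j, is_succ le j i | is_limit le i].
Proof.
have [z|nz] := pselect (is_zero le i); first exact: Or31.
have [s|ns] := pselect (exists j, is_succ le j i); first exact: Or32.
by apply: Or33; split=> // j sj; apply: ns; exists j.
Qed.

End WellOrder.

(** * Positions ordered by extension, and plays as increasing sequences *)

Section Positions.
Variable H : graph.
Implicit Types G S : pregraph H.

Definition pext G G' : Prop :=
  pedges G `<=` pedges G' /\ pnonedges G `<=` pnonedges G'.

Lemma pext_refl G : pext G G.
Proof. by split. Qed.

Lemma pext_trans G2 G1 G3 : pext G1 G2 -> pext G2 G3 -> pext G1 G3.
Proof. by move=> [a b] [c d]; split; [exact: subset_trans c|exact: subset_trans d]. Qed.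

Lemma pregraph_eq G G' :
  pedges G = pedges G' -> pnonedges G = pnonedges G' -> G = G'.
Proof.
case: G G' => [E N s d] [E' N' s' d'] /= eE eN; subst E' N'.
by rewrite (Prop_irrelevance s s') (Prop_irrelevance d d').
Qed.

Lemma pext_anti G G' : pext G G' -> pext G' G -> G = G'.
Proof. by move=> [a b] [c d]; apply: pregraph_eq; apply/seteqP. Qed.

Lemma pext_determined G G' : pext G G' -> determined G `<=` determined G'.
Proof. by move=> [a b] e [/a|/b]; [left|right]. Qed.

Lemma pext_undetermined G G' :
  pext G G' -> undetermined G' `<=` undetermined G.
Proof. by move=> GG' e [eH ne]; split=> // /(pext_determined GG'). Qed.

Lemma step_pext G e G' : step G e G' -> pext G G'.
Proof. by rewrite /pext => -[_ [[-> ->]|[-> ->]]]; split=> // x; left. Qed.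

Lemma step_determined G e G' :
  step G e G' -> determined G' = determined G `|` [set e].
Proof.
by rewrite /determined => -[_ [[-> ->]|[-> ->]]]; [rewrite setUAC|rewrite setUA].
Qed.

Section Play.
Variables (P : graph_property) (I : Type) (le : rel I).
Variables (G : I -> pregraph H) (b : I).
Hypothesis playG : is_play P le G b.

Lemma play_mono i j : le i j -> pext (G i) (G j).
Proof.
have wo := play_wo playG.
elim/(wo_ind wo): j i => j IH i ij.
have [->|ne] := pselect (i = j); first exact: pext_refl.
have ltij : slt le i j by [].
have [z|[k kj]|lj] := zero_succ_limit le j.
- by case: (z i).
- have [e /step_pext st] := play_succ playG kj.
  by apply: pext_trans st; apply: IH; [exact: kj.1|exact: (wo_le_succ wo kj)].
- have [eE eN] := play_limit playG lj.
  by split; rewrite ?eE ?eN; apply: (bigcup_sup (i := i)).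
Qed.

(** The current position is the largest element of the history, so a positional rule can serve as a
    strategy. *)
Lemma history_last j :
  history le G j (G j) /\ forall X, history le G j X -> pext X (G j).
Proof.
split; first by exists j => //; exact: wo_refl (play_wo playG) _.
by move=> _ [i ij <-]; exact: play_mono.
Qed.

End Play.

(** * Winning positions and the composition of rounds *)

Section WinningPositions.
Variable P : graph_property.

(** Only moves from stage [i0] on must follow [s], yet [s] sees the whole history, including the
    arbitrary moves that led to [S]. This lets strategies be chained. *)
Definition wins_from S (s : strategy H) : Prop :=
  forall (I : Type) (le : rel I) (G : I -> pregraph H) (b i0 : I),
    is_play P le G b -> G i0 = S ->
    (forall j i, le i0 j -> is_succ le j i ->
       step (G j) (s (history le G j)) (G i)) ->
    (~ terminal P (G b) -> undetermined (G b) (s (history le G b))) /\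
    (terminal P (G b) -> ~ bob_wins_at (G b)).

Definition winning_position S : Prop := exists s, wins_from S s.

Lemma winning_position_terminal S :
  terminal P S -> undetermined S !=set0 -> winning_position S.
Proof.
move=> tS [e [eH ne]]; exists (fun _ => set0) => I le G b i0 playG eqS _.
have eqb : i0 = b.
  apply: contrapT => ne'; apply: (play_running playG (i := i0)).
    by split=> //; exact: (play_last playG).
  by rewrite eqS.
rewrite -eqb eqS; split=> // _; rewrite /bob_wins_at => eqd.
by apply: ne; rewrite eqd.
Qed.

Lemma winning_position_start S :
  pedges S = set0 -> pnonedges S = set0 -> winning_position S ->
  alice_has_winning_strategy H P.
Proof.
move=> eS nS [s sS]; exists s => I le G b playG fol.
have wo := play_wo playG.
have [|z _ zmin] := @wo_least _ _ wo [set: I]; first by exists b.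
have zz : is_zero le z by move=> j /(wo_ltNle wo); apply; exact: zmin.
apply: (sS _ _ _ _ z playG); last by move=> j i _; exact: fol.
have [eG nG] := play_zero playG zz.
by apply: pregraph_eq; rewrite ?eG ?nG.
Qed.

(* Alice plays the positional strategy [sigma] until [stop] holds, and then
   switches to a strategy that wins from the position reached.  Nothing forces
   [stop] to ever hold: as long as it fails, [sigma] provides an undetermined
   pair, so that the end of the game is not a win for Bob. *)
Lemma winning_position_phase S (sigma : pregraph H -> set H)
    (inv stop : pregraph H -> Prop) :
  inv S ->
  (forall G, pext S G -> inv G -> ~ stop G -> undetermined G (sigma G)) ->
  (forall G G', pext S G -> inv G -> ~ stop G -> step G (sigma G) G' -> inv G') ->
  (forall (C : set (pregraph H)) G', C S ->
     (forall G, C G -> [/\ pext S G, inv G & ~ stop G]) ->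
     pedges G' = \bigcup_(G in C) pedges G ->
     pnonedges G' = \bigcup_(G in C) pnonedges G -> inv G') ->
  (forall G, pext S G -> inv G -> stop G -> winning_position G) ->
  winning_position S.
Proof.
move=> invS legal invstep invlim winstop.
pose cand := [set X | [/\ pext S X, inv X & stop X]].
have [t tP] : exists t, forall X, cand X -> wins_from X (t X).
  suff /choice[t tP] : forall X, exists s, cand X -> wins_from X s by exists t.
  move=> X; have [[SX iX /(winstop _ SX iX)[s sX]]|nX] := pselect (cand X).
    by exists s.
  by exists (fun _ => set0).
(* By antisymmetry of [pext] a history has at most one least candidate, so the switching point can
   be read off the history alone. *)
pose first_cand (h : set (pregraph H)) :=
  [set X | [/\ h X, cand X & forall Y, h Y -> cand Y -> pext X Y]].
pose last_pos (h : set (pregraph H)) :=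
  [set X | h X /\ forall Y, h Y -> pext Y X].
have [fc fcP] := choose_some first_cand S.
have [lp lpP] := choose_some last_pos S.
pose s h := if pselect (exists X, h X /\ cand X)
  then t (fc h) h else sigma (lp h).
have sE h X : h X -> cand X -> (forall Y, h Y -> cand Y -> pext X Y) ->
    s h = t X h.
  move=> hX cX Xmin; rewrite /s; case: pselect => [? /=|[]]; last by exists X.
  have [hY cY Ymin] : first_cand h (fc h) by apply: (fcP h X).
  by congr (t _ h); apply: pext_anti; [exact: Ymin|exact: Xmin].
have sN h X : ~ (exists X, h X /\ cand X) -> h X -> (forall Y, h Y -> pext Y X) ->
    s h = sigma X.
  move=> nc hX Xmax; rewrite /s; case: pselect => // ? /=.
  have [hY Ymax] : last_pos h (lp h) by apply: (lpP h X).
  by congr (sigma _); apply: pext_anti; [exact: Xmax|exact: Ymax].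
exists s => I le G b i0 playG eqS fol.
have wo := play_wo playG.
have SG i : le i0 i -> pext S (G i) by rewrite -eqS; exact: (play_mono playG).
(* A position before stage [i0] lies below [S], so it is a candidate only if it equals [S]. *)
have early i : ~ le i0 i -> cand (G i) -> G i = S.
  move=> /(wo_leNlt wo)[ii _] [SX _ _]; apply: pext_anti => //.
  by rewrite -eqS; exact: (play_mono playG).
have nostop j : le i0 j -> (forall i, le i0 i -> le i j -> ~ stop (G i)) ->
    s (history le G j) = sigma (G j).
  move=> ij ns; have [hj hmax] := history_last playG j.
  apply: sN => // -[_ [[i ilj <-] ci]].
  have [ii|nii] := pselect (le i0 i); first by case: (ns i ii ilj); case: ci.
  apply: (ns i0) => //; first exact: (wo_refl wo).
  by rewrite eqS -(early _ nii ci); case: ci.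
have invG i : le i0 i -> (forall j, le i0 j -> slt le j i -> ~ stop (G j)) ->
    inv (G i).
  elim/(wo_ind wo): i => i IH ii ns.
  have [<-|ne] := pselect (i0 = i); first by rewrite eqS.
  have lt0 : slt le i0 i by [].
  have IH' j : le i0 j -> slt le j i -> inv (G j).
    move=> ij ji; apply: IH => // k ik kj; apply: ns => //.
    by apply: (wo_le_lt_trans wo) ji; exact: kj.1.
  have [z|[k ki]|li] := zero_succ_limit le i; first by case: (z i0).
  - have ik := wo_le_succ wo ki lt0.
    apply: (invstep (G k)); [exact: SG|by apply: IH' => //; exact: ki.1|
      by apply: ns => //; exact: ki.1|].
    rewrite -nostop//; first exact: fol.
    by move=> j ij jk; apply: ns => //; exact: (wo_le_lt_trans wo jk ki.1).
  - have [eE eN] := play_limit playG li.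
    pose D := [set j | le i0 j /\ slt le j i].
    (* The stages from [i0] on are cofinal below [i], so by monotonicity they yield the same
       union. *)
    have reindex (F : pregraph H -> set (set H)) :
        (forall j k, le j k -> F (G j) `<=` F (G k)) ->
        \bigcup_(j in [set j | slt le j i]) F (G j) =
        \bigcup_(X in [set G j | j in D]) F X.
      move=> Fmono; rewrite bigcup_image; apply/seteqP; split=> e [j jD je].
        have [ij|ji] := wo_total wo i0 j; first by exists j.
        exists i0; last exact: Fmono je.
        by split=> //; exact: (wo_refl wo).
      by exists j => //; case: jD.
    apply: (invlim [set G j | j in D]).
    + by exists i0 => //; split=> //; exact: (wo_refl wo).
    + by move=> _ [j [ij ji] <-]; split; [exact: SG|exact: IH'|exact: ns].
    + by rewrite eE reindex// => j k jk; case: (play_mono playG jk).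
    + by rewrite eN reindex// => j k jk; case: (play_mono playG jk).
(* If [stop] never holds, the pair offered by [sigma] at stage [b] is undetermined, so Bob has not
   won. *)
have [[i [ii si]]|ns] := pselect (exists i, le i0 i /\ stop (G i)); last first.
  have ns' i : le i0 i -> ~ stop (G i) by move=> ii si; apply: ns; exists i.
  have ib : le i0 b := play_last playG i0.
  have ub : undetermined (G b) (sigma (G b)).
    by apply: legal; [exact: SG|apply: invG => // j ij _; exact: ns'|exact: ns'].
  split; first by rewrite nostop// => i' ? _; exact: ns'.
  by move=> _ eqd; case: ub => eH; apply; rewrite eqd.
(* From the first stage [i1] at which [stop] holds, [s] agrees with the strategy chosen for
   [G i1]. *)
have [|i1 [ii1 si1] i1min] := @wo_least _ _ wo [set i | le i0 i /\ stop (G i)].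
  by exists i.
have c1 : cand (G i1).
  split=> //; first exact: SG.
  apply: invG => // j ij /(wo_ltNle wo) ji sj; apply: ji.
  exact: i1min.
have s1 j : le i1 j -> s (history le G j) = t (G i1) (history le G j).
  move=> ij; apply: sE => //; first by exists i1.
  move=> _ [k kj <-] ck; have [ik|nik] := pselect (le i0 k).
    by apply: (play_mono playG); apply: i1min; split=> //; case: ck.
  have eqk := early _ nik ck; rewrite eqk -eqS; apply: (play_mono playG).
  by apply: i1min; split; [exact: (wo_refl wo)|rewrite eqS -eqk; case: ck].
rewrite s1; last exact: (play_last playG).
apply: (tP _ c1 _ _ _ _ i1 playG) => // j k ij jk.
by rewrite -s1//; apply: fol => //; exact: (wo_trans wo ii1 ij).
Qed.

Lemma step_undetermined G e G' :
  step G e G' -> undetermined G' = undetermined G `\ e.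
Proof. by move/step_determined; rewrite /undetermined => ->; rewrite -setDDl. Qed.

(** The round stops when [Q] is exhausted, pairs outside [Q] being left alone. If the game
    terminates earlier, a pair of [Q] is still undetermined and Alice has won. *)
Lemma winning_position_ask_all S (Q : set (set H)) :
  (forall G, pext S G -> undetermined G = undetermined S `\` Q ->
     winning_position G) ->
  winning_position S.
Proof.
move=> winG.
have [sigma sigmaP] := choose_some (fun G => undetermined G `&` Q) set0.
apply: (@winning_position_phase S sigma
  (fun G => undetermined S `\` Q `<=` undetermined G)
  (fun G => undetermined G `&` Q = set0)).
- by move=> e [].
- by move=> G _ _ /eqP/set0P[e /sigmaP[]].
- move=> G G' _ inv /eqP/set0P[e /sigmaP[_ Qs]] /step_undetermined ->.
  by move=> f [uf nQf]; split; [exact: inv|move=> eqf; apply: nQf; rewrite eqf].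
- move=> C G' _ CP eE eN e [ue nQ]; split; first by case: ue.
  by case; rewrite ?eE ?eN => -[G CG Ge]; have [_ /(_ e)[]] := CP _ CG => // _; case;
    [left|right].
- move=> G SG inv stop; apply: winG => //; apply/seteqP; split=> // e ue.
  split; first exact: (pext_undetermined SG).
  by move=> Qe; have : (undetermined G `&` Q) e by []; rewrite stop.
Qed.

Lemma winning_position_probe S (e : nat -> set H) :
  injective e -> (forall i, undetermined S (e i)) ->
  (forall G k, pext S G -> pedges G (e k) ->
     undetermined G = undetermined S `\` [set e i | i in `I_k.+1] ->
     winning_position G) ->
  (forall G, pext S G -> pedges G = pedges S ->
     undetermined G = undetermined S `\` range e -> winning_position G) ->
  winning_position S.
Proof.
move=> inje ue winyes winno.
have [least leastP] := choose_some (fun G => [set k |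
  undetermined G (e k) /\ forall i, undetermined G (e i) -> k <= i]) 0.
have lP G : (exists i, undetermined G (e i)) -> undetermined G (e (least G)) /\
    forall i, undetermined G (e i) -> least G <= i.
  move=> [i ui]; have ex : exists i, `[< undetermined G (e i) >].
    by exists i; apply/asboolP.
  case: (ex_minnP ex) => k /asboolP uk kmin; apply: (leastP _ k).
  by split=> // j uj; apply: kmin; apply/asboolP.
(* Invariant: pairs outside the sequence are untouched, the undetermined probes form a final
   segment, and the only possible new edge is the last pair probed. *)
apply: (@winning_position_phase S (e \o least)
  (fun G => [/\ undetermined S `\` range e `<=` undetermined G,
    forall i j, i <= j -> undetermined G (e i) -> undetermined G (e j) &
    pedges G = pedges S \/ exists k, pedges G (e k) /\
      forall j, undetermined G (e j) <-> k < j])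
  (fun G => (exists k, pedges G (e k)) \/ forall k, ~ undetermined G (e k))).
- by split=> [f []//|//|]; left.
- move=> G _ _ nstop.
  have /lP[] // : exists i, undetermined G (e i).
  apply: contrapT => nex; apply: nstop; right=> k uk.
  by apply: nex; exists k.
- move=> G G' _ [inv1 inv2 inv3] nstop st.
  have /lP[ul lmin] : exists i, undetermined G (e i).
    apply: contrapT => nex; apply: nstop; right=> k uk.
    by apply: nex; exists k.
  have eqE : pedges G = pedges S.
    by case: inv3 => // -[k [Ek _]]; case: nstop; left; exists k.
  have uG' := step_undetermined st.
  have uE j : undetermined G' (e j) <-> least G < j.
    rewrite uG'; split=> [[uj /= nj]|lj].
      by rewrite ltn_neqAle lmin// andbT; apply/eqP => lj; apply: nj; rewrite lj.
    split; first exact: inv2 (ltnW lj) ul.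
    by move=> /= /inje eqj; rewrite eqj ltnn in lj.
  split.
  + move=> f [uf nf]; rewrite uG'; split; first exact: inv1.
    by move=> /= eqf; apply: nf; exists (least G).
  + by move=> i j ij /uE li; apply/uE; exact: leq_trans ij.
  + case: st => _ [[-> _]|[-> _]]; last by left.
    by right; exists (least G); split=> //; right.
- move=> C G' CS CP eE eN.
  have uE f : undetermined G' f <-> forall G, C G -> undetermined G f.
    split=> [[fH nf] G CG|uf].
      split=> // -[]df; apply: nf; [left|right]; rewrite ?eE ?eN; by exists G.
    split; first by have [] := uf _ CS.
    by case; rewrite ?eE ?eN => -[G CG df]; have [_] := uf _ CG; apply; [left|right].
  split.
  + by move=> f uf; apply/uE => G /CP[_ [inv1 _ _] _]; exact: inv1.
  + move=> i j ij /uE ui; apply/uE => G CG.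
    by have [_ [_ inv2 _] _] := CP _ CG; apply: inv2 ij (ui _ CG).
  (* Before a limit [stop] has always failed, so no edge has been added. *)
  + left; rewrite eE; apply/seteqP; split=> [f [G CG Gf]|f Sf]; last by exists S.
    have [_ [_ _ inv3] nstop] := CP _ CG.
    case: inv3 => [<-//|[k [Ek _]]].
    by case: nstop; left; exists k.
- move=> G SG [inv1 inv2 inv3] stop.
  case: inv3 => [eqE|[k [Ek uk]]]; last first.
    apply: (winyes _ k) => //; apply/seteqP; split=> [f uf|f [uf nf]].
      split; first exact: (pext_undetermined SG).
      by move=> [i /= ik eqi]; move: uf; rewrite -eqi uk ltnNge -ltnS ik.
    have [[i _ eqi]|nr] := pselect (range e f); last exact: inv1.
    rewrite -eqi uk ltnNge; apply/negP => ik; apply: nf.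
    by exists i.
  case: stop => [[k]|nu].
    by rewrite eqE => Ek; case: (ue k) => _; case; left.
  apply: winno => //; apply/seteqP; split=> // f uf; split.
    exact: (pext_undetermined SG).
  by move=> [i _ eqi]; apply: (nu i); rewrite eqi.
Qed.

(** * Properties that require every vertex to be satisfied *)

Section VertexProperty.
Variable sat : set (set H) -> H -> Prop.
Hypothesis P_sat : forall E (EH : E `<=` edges H),
  P (hgraph EH) <-> forall x, sat E x.
Hypothesis sat_mono : forall E E' x, E `<=` E' -> sat E x -> sat E' x.
Hypothesis sat_addN : forall E x y z,
  sat E x -> sat E y -> sat (E `|` [set [set x; y]]) z -> sat E z.

Lemma winning_position_unsat S x :
  (forall E, E `<=` edges H -> extends E S -> ~ sat E x) ->
  undetermined S !=set0 -> winning_position S.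
Proof.
move=> unsat; apply: winning_position_terminal; right=> E EH ES /P_sat/(_ x).
exact: unsat.
Qed.

(** Alice asks every other pair. The position is then terminal: if all vertices are satisfied, they
    remain so by [sat_mono]; if one is not, the pair of [x] and [y] cannot help it by [sat_addN]. *)
Lemma winning_position_sat2 S x y :
  undetermined S [set x; y] -> sat (pedges S) x -> sat (pedges S) y ->
  winning_position S.
Proof.
move=> uxy sx sy; apply: (@winning_position_ask_all S (~` [set [set x; y]])).
move=> G SG uG.
have uGE : undetermined G = [set [set x; y]].
  by rewrite uG setDE setCK; apply/seteqP; split=> [e [_ ->]//|e ->].
apply: winning_position_terminal; last by rewrite uGE; exists [set x; y].
have [all_sat|/existsNP[z nz]] := pselect (forall z, sat (pedges G) z).
  by left=> E EH [GE _]; apply/P_sat => z; exact: sat_mono (all_sat z).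
right=> E EH [GE NE] /P_sat/(_ z) sz; apply: nz.
have [sub _] := SG.
apply: (@sat_addN _ x y); [exact: sat_mono sx|exact: sat_mono sy|].
apply: sat_mono sz => e Ee.
have [[]|ndet] := pselect (determined G e); first by left.
  by move=> Ne; have : (pnonedges G `&` E) e by []; rewrite NE.
right; rewrite -uGE; split=> //; exact: EH.
Qed.

End VertexProperty.
End WinningPositions.
End Positions.

(** * Infinite sets, pigeonhole arguments and unordered pairs *)

Section Cardinality.
Variable T : Type.
Implicit Types A B K : set T.

Lemma infinite_card_ge A n : infinite_set A -> `I_n #<= A.
Proof. by move/infiniteP; apply: card_le_trans; exact: subset_card_le. Qed.

Lemma infinite_set_inj A :
  infinite_set A -> exists2 f : nat -> T, injective f & forall i, A (f i).
Proof.
elim/Ppointed: T A => U A; first by rewrite emptyE => /(_ (finite_set0 _)).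
move=> /infiniteP/pcard_leP[f]; exists f => [i j|i]; last exact: funS.
by apply: inj; rewrite in_setT.
Qed.

Lemma range_inj_infinite (f : nat -> T) : injective f -> infinite_set (range f).
Proof.
by move=> injf; apply/infiniteP; rewrite (card_le_eqr (inj_card_eq _))// => i j _ _ /injf.
Qed.

Lemma card_ge_addl A B b n :
  `I_n #<= A -> A `<=` B -> B b -> ~ A b -> `I_n.+1 #<= B.
Proof.
move=> /pcard_surjP[g gA] AB Bb nAb; apply/pcard_surjP.
exists (fun x => if pselect (x = b) then n else g x) => i /=.
rewrite ltnS leq_eqVlt => /orP[/eqP ->|ilt].
  by exists b => //; case: pselect.
have [x Ax <-] := gA _ ilt; exists x; first exact: AB.
by case: pselect => // xb; case: nAb; rewrite -xb.
Qed.

(** Otherwise choosing, for each [i < m], one of [l i] and [r i] that lies in [K] would inject [I_m]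
    into [K]. *)
Lemma card_lt_pigeonhole K (l r : nat -> T) m :
  injective l -> injective r -> (forall i j, l i <> r j) -> ~ (`I_m #<= K) ->
  exists i, [/\ i < m, ~ K (l i) & ~ K (r i)].
Proof.
move=> injl injr lr nK; apply: contrapT => nex; apply: nK.
pose f i := if pselect (K (l i)) then l i else r i.
have injf : injective f.
  move=> i j; rewrite /f; do 2![case: pselect => ? /=].
  - exact: injl.
  - by move/lr.
  - by move/esym/lr.
  - exact: injr.
have <- := card_le_eql (B := `I_m) (inj_card_eq (f := f) (in2W injf)).
apply: subset_card_le => _ [i /= im <-]; rewrite /f; case: pselect => //= nl.
by apply: contrapT => nr; apply: nex; exists i.
Qed.

Lemma infinite_setDI A B :
  infinite_set A -> finite_set (A `&` B) -> infinite_set (A `\` B).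
Proof. by move=> infA finI finD; apply: infA; rewrite -(setUIDK A B) finite_setU. Qed.

(** Enumerate part of [A] and halve it into [E] and [O]. If [E] meets [B] in a finite set, take [E]
    without [B], and [B]; otherwise take [O], and the part of [B] in [E]. *)
Lemma infinite_split A B : infinite_set A -> infinite_set B ->
  exists A' B', [/\ A' `<=` A, B' `<=` B, infinite_set A', infinite_set B' &
    A' `&` B' = set0].
Proof.
move=> infA infB; have [f injf Af] := infinite_set_inj infA.
pose E := range (fun k => f k.*2); pose O := range (fun k => f k.*2.+1).
have infE : infinite_set E.
  by apply: range_inj_infinite => i j /injf/double_inj.
have infO : infinite_set O.
  by apply: range_inj_infinite => i j /injf[]/double_inj.
have OE : O `&` E = set0.
  apply/seteqP; split=> // x [[i _ <-] [j _ /injf]]; lia.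
have [finEB|infEB] := pselect (finite_set (E `&` B)).
  exists (E `\` B), B; split=> //.
  - by move=> _ [[k _ <-] _].
  - exact: infinite_setDI.
  - by apply/seteqP; split=> // x [[]].
exists O, (E `&` B); split=> //.
- by move=> _ [k _ <-].
- by rewrite setIA OE set0I.
Qed.

Lemma set2_eq (x y z w : T) :
  [set x; y] = [set z; w] -> x = z /\ y = w \/ x = w /\ y = z.
Proof.
move=> e.
have hx : [set z; w] x by rewrite -e; left.
have hy : [set z; w] y by rewrite -e; right.
have hz : [set x; y] z by rewrite e; left.
have hw : [set x; y] w by rewrite e; right.
case: hx hy hz hw => /= h1 [] /= h2 [] /= h3 [] /= h4; intuition congruence.
Qed.

Lemma set2_injr (x y z : T) : [set x; y] = [set x; z] -> y = z.
Proof. by move=> /set2_eq[[]//|[-> ->]]. Qed.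

End Cardinality.
Arguments set2_eq {T x y z w}.
Arguments set2_injr {T x y z}.

(** * Edges of extensions, and bicliques *)

Section Answers.
Variable H : graph.
Implicit Types G : pregraph H.

Lemma extends_pedges G E e : E `<=` edges H -> extends E G -> E e ->
  ~ undetermined G e -> pedges G e.
Proof.
move=> EH [_ NE] Ee nu; apply: contrapT => nE; apply: nu.
split; first exact: EH.
by case=> // Ne; have : (pnonedges G `&` E) e by []; rewrite NE.
Qed.

Lemma pedges_edges G e : pedges G e -> edges H e.
Proof. by move=> Ge; apply: (@pregraph_sub _ G); left. Qed.

Lemma pext_extends G G' : pext G G' -> extends (pedges G') G.
Proof.
move=> [GE GN]; split=> //; apply/seteqP; split=> // e [/GN Ne Ee].
by have : (pedges G' `&` pnonedges G') e by []; rewrite pregraph_disj.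
Qed.

Lemma pedges_old G G' e :
  pext G G' -> pedges G' e -> ~ undetermined G e -> pedges G e.
Proof.
move=> GG' Ge; apply: extends_pedges (pext_extends GG') Ge => f.
exact: pedges_edges.
Qed.

End Answers.

(** Pairs within one side are unconstrained: the biclique need not be induced. *)
Definition biclique (H : graph) (l r : nat -> H) : Prop :=
  [/\ injective l, injective r, forall i j, l i <> r j &
      forall i j, edges H [set l i; r j]].

Lemma biclique_sym (H : graph) (l r : nat -> H) : biclique l r -> biclique r l.
Proof.
by move=> [a b c d]; split=> // [i j /esym/c//|i j]; rewrite setUC.
Qed.

Lemma empty_pregraph (H : graph) :
  exists S : pregraph H, pedges S = set0 /\ pnonedges S = set0.
Proof.
have sub : set0 `|` set0 `<=` edges H by rewrite setUid; exact: sub0set.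
by exists (Pregraph sub (set0I set0)).
Qed.

(** * Minimum degree *)

Section Degree.
Variables (H : graph) (n : nat).
Implicit Types S G : pregraph H.

Local Notation wins := (winning_position (min_degree_ge n)).
Local Notation nbrs E x := [set y : H | E [set x; y]].

Definition degree_ge (E : set (set H)) (x : H) : Prop := `I_n #<= nbrs E x.

Lemma min_degree_geP E (EH : E `<=` edges H) :
  min_degree_ge n (hgraph EH) <-> forall x, degree_ge E x.
Proof. by []. Qed.

Lemma degree_ge_mono E E' x : E `<=` E' -> degree_ge E x -> degree_ge E' x.
Proof.
move=> EE' h; apply: card_le_trans h _.
by apply: subset_card_le => y /=; exact: EE'.
Qed.

Lemma degree_ge_addN E x y z : degree_ge E x -> degree_ge E y ->
  degree_ge (E `|` [set [set x; y]]) z -> degree_ge E z.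
Proof.
move=> dx dy dz.
have [->//|zx] := pselect (z = x); have [->//|zy] := pselect (z = y).
apply: card_le_trans dz _; apply: subset_card_le => w /= [//|e].
by case: (set2_eq e) => -[? ?]; [case: zx|case: zy].
Qed.

Let wins_sat2 := winning_position_sat2 min_degree_geP degree_ge_mono degree_ge_addN.
Let wins_unsat := winning_position_unsat min_degree_geP.

(** Induction on [d], a bound on the neighbours that [a] still lacks. A positive answer lowers [d];
    if all answers are negative, [a] is doomed while the guard [e] is undetermined. *)
Lemma degree_probe d S (a : H) (b : nat -> H) :
  injective b -> (forall j, undetermined S [set a; b j]) ->
  (forall j, degree_ge (pedges S) (b j)) ->
  (forall y, undetermined S [set a; y] -> exists j, y = b j) ->
  (exists2 e, undetermined S e & ~ e a) ->
  `I_(n - d) #<= nbrs (pedges S) a -> wins S.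
Proof.
elim: d S b => [|d IH] S b injb ub sb ua guard da.
  by apply: (wins_sat2 (ub 0)) => //; rewrite /degree_ge -[n]subn0.
have [sa|nsa] := pselect (degree_ge (pedges S) a).
  exact: (wins_sat2 (ub 0)).
apply: (@winning_position_probe _ _ S (fun j => [set a; b j])) => //.
- by move=> i j /set2_injr/injb.
- move=> G k SG Gk uG.
  apply: (IH G (fun j => b (k.+1 + j))).
  + by move=> i j /injb/addnI.
  + move=> j; rewrite uG; split=> // -[i /= ik /set2_injr/injb]; lia.
  + by move=> j; apply: degree_ge_mono (sb _); case: SG.
  + move=> y; rewrite uG => -[/ua[j ->] nj].
    exists (j - k.+1); rewrite subnKC// ltnNge -ltnS.
    by apply/negP => jk; apply: nj; exists j.
  + have [e ue nea] := guard; exists e => //; rewrite uG; split=> //.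
    by move=> [i _ eqe]; apply: nea; rewrite -eqe; left.
  + have : `I_(n - d.+1).+1 #<= nbrs (pedges G) a.
      apply: (card_ge_addl (b := b k)) da _ _ _ => //.
        by move=> y /=; case: SG => h _; exact: h.
      by move=> /= Sk; case: (ub k) => _; apply; left.
    by apply: card_le_trans; rewrite card_le_II; lia.
- move=> G SG eqE uG.
  apply: (@wins_unsat G a).
    move=> E EH EG dE; apply: nsa; apply: card_le_trans dE _.
    apply: subset_card_le => y /= Ey; rewrite -eqE.
    apply: (extends_pedges EH EG Ey); rewrite uG => -[/ua[j ->]].
    by apply; exists j.
  have [e ue nea] := guard; exists e; rewrite uG; split=> //.
  by move=> [i _ eqe]; apply: nea; rewrite -eqe; left.
Qed.

Definition double_star (l r : nat -> H) : set (set H) :=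
  [set e | (exists j, e = [set l 0; r j]) \/ (exists i, e = [set l i; r 0])].

Lemma double_star_sym l r : double_star l r = double_star r l.
Proof.
rewrite /double_star; apply/seteqP; split=> e [] [j ->]; rewrite setUC.
- by right; exists j.
- by left; exists j.
- by right; exists j.
- by left; exists j.
Qed.

Lemma degree_many_sat (l r : nat -> H) G : biclique l r ->
  undetermined G = double_star l r ->
  infinite_set [set j | degree_ge (pedges G) (r j.+1)] -> wins G.
Proof.
move=> [injl injr lr _] uG /infinite_set_inj[b injb sb].
(* The guard joining [l 1] and [r 0] avoids [l 0]. *)
pose U := [set e | (exists j, e = [set l 0; r (b j).+1]) \/ e = [set l 1; r 0]].
apply: (@winning_position_ask_all _ _ G (~` U)) => G' GG' uG'.
have {}uG' : undetermined G' = U.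
  rewrite uG' setDE setCK setIC uG; apply: setIidl.
  by move=> e [[j ->]|->]; [left|right]; [exists (b j).+1|exists 1].
apply: (@degree_probe n G' (l 0) (fun j => r (b j).+1)).
- by move=> i j /injr[]/injb.
- by move=> j; rewrite uG'; left; exists j.
- by move=> j; apply: degree_ge_mono (sb j); case: GG'.
- move=> y; rewrite uG' => -[[j /set2_injr ->]|/set2_eq[[/injl//]|[/lr//]]].
  by exists j.
- exists [set l 1; r 0]; first by rewrite uG'; right.
  by case=> [/injl|/lr].
- by rewrite subnn II0; exact: card_ge0.
Qed.

(** The only undetermined pair at [r j.+1] goes to [l 0]. If [r j.+1] was unsatisfied in [G] and is
    satisfied in [G'], this pair became an edge; infinitely many such [j] give [l 0] infinite
    degree. *)
Lemma degree_forced (l r : nat -> H) G G' : biclique l r -> pext G G' ->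
  undetermined G = double_star l r ->
  finite_set [set j | degree_ge (pedges G) (r j.+1)] ->
  (forall z, z <> l 0 -> z <> r 0 -> degree_ge (pedges G') z) ->
  degree_ge (pedges G') (l 0).
Proof.
move=> [injl injr lr _] GG' uG finJ sat; apply: infinite_card_ge.
set J := (X in finite_set X) in finJ.
have infJ : infinite_set (~` J).
  by rewrite -setTD; apply: infinite_setD => //; exact: infinite_nat.
suff sub : [set r j.+1 | j in ~` J] `<=` nbrs (pedges G') (l 0).
  move=> fin; apply: infJ; have := sub_finite_set sub fin.
  apply: card_le_finite; rewrite (card_le_eqr (inj_card_eq _))//.
  by move=> i j _ _ /injr[].
move=> _ [j nJ <-] /=; apply: contrapT => nE; apply: nJ => /=.
have : degree_ge (pedges G') (r j.+1) by apply: sat => [/esym/lr|/injr].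
move=> s; apply: card_le_trans s _; apply: subset_card_le => y /= Ey.
apply: (pedges_old GG' Ey); rewrite uG => -[[k]|[k]] /set2_eq[].
- by case=> /esym/lr.
- by case=> _ y0; apply: nE; rewrite -y0 setUC.
- by case=> /esym/lr.
- by case=> /injr.
Qed.

Lemma min_degree_not_elusive (l r : nat -> H) :
  biclique l r -> alice_has_winning_strategy H (min_degree_ge n).
Proof.
move=> lrP; have rlP := biclique_sym lrP.
have [S [ES NS]] := empty_pregraph H.
apply: (winning_position_start ES NS).
have uS : undetermined S = edges H.
  by rewrite /undetermined /determined ES NS setU0 setD0.
apply: (@winning_position_ask_all _ _ S (~` double_star l r)) => G _ uG.
have {}uG : undetermined G = double_star l r.
  rewrite uG uS setDE setCK setIC; apply: setIidl.
  by case: lrP => _ _ _ lrE e [[j ->]|[j ->]].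
have [finr|/(degree_many_sat lrP uG)//] :=
  pselect (finite_set [set j | degree_ge (pedges G) (r j.+1)]).
have uG' : undetermined G = double_star r l by rewrite double_star_sym.
have [finl|/(degree_many_sat rlP uG')//] :=
  pselect (finite_set [set j | degree_ge (pedges G) (l j.+1)]).
apply: (@winning_position_ask_all _ _ G (~` [set [set l 0; r 0]])).
move=> G' GG' uG2.
have {}uG2 : undetermined G' = [set [set l 0; r 0]].
  rewrite uG2 setDE setCK setIC; apply: setIidl => _ ->.
  by rewrite uG; left; exists 0.
have [sat|] := pselect (forall z, z <> l 0 -> z <> r 0 -> degree_ge (pedges G') z).
  apply: (@wins_sat2 G' (l 0) (r 0)); first by rewrite uG2.
    exact: degree_forced lrP GG' uG finr sat.
  by apply: (degree_forced rlP GG' uG' finl) => z ? ?; exact: sat.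
(* All pairs at this unsatisfied [z] are determined, so it is doomed. *)
move=> /existsNP[z /not_implyP[zl /not_implyP[zr nz]]].
apply: (@wins_unsat G' z); last by exists [set l 0; r 0]; rewrite uG2.
move=> E EH EG' dE; apply: nz; apply: card_le_trans dE _.
apply: subset_card_le => y /= Ey; apply: (extends_pedges EH EG' Ey).
by rewrite uG2 => /set2_eq[[]|[]].
Qed.

End Degree.

(** * Component size *)

Section Component.
Variables (H : graph) (m : nat).
Implicit Types (S G : pregraph H) (E : set (set H)).

Local Notation wins := (winning_position (component_size_ge m)).

Definition component E (x : H) : set H :=
  [set y | clos_refl_trans H (fun u v => E [set u; v]) x y].

Definition component_ge E (x : H) : Prop := `I_m #<= component E x.

Lemma component_size_geP E (EH : E `<=` edges H) :
  component_size_ge m (hgraph EH) <-> forall x, component_ge E x.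
Proof.
split=> [h x|h C [x ->]]; last exact: (h x).
by apply: h; exists x.
Qed.

Lemma component_refl E x : component E x x.
Proof. exact: rt_refl. Qed.

Lemma component_trans E y x z :
  component E x y -> component E y z -> component E x z.
Proof. exact: rt_trans. Qed.

Lemma component_edge E x y : E [set x; y] -> component E x y.
Proof. exact: rt_step. Qed.

Lemma component_sym E x y : component E x y -> component E y x.
Proof.
elim=> [u v Euv|u|u v w _ vu _ wv]; last exact: component_trans wv vu.
  by apply: component_edge; rewrite setUC.
exact: component_refl.
Qed.

Lemma component_eq E x y : component E x y -> component E x = component E y.
Proof.
move=> xy; apply/seteqP; split=> z; apply: component_trans => //.
exact: component_sym.
Qed.

(** Induction along paths. It bounds a component by checking closure only at vertices of that
    component. *)
Lemma component_closed E x (A : set H) : A x ->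
  (forall u v, A u -> component E x u -> E [set u; v] -> A v) ->
  component E x `<=` A.
Proof.
move=> Ax cl y.
suff gen u : component E u y -> component E x u -> A u -> A y.
  by move=> /gen; apply=> //; exact: component_refl.
elim=> {u y} // [u v Euv xu Au|u v w uv IHv vw IHw xu Au].
  exact: cl Euv.
by apply: IHw; [exact: component_trans uv|exact: IHv].
Qed.

Lemma component_mono E E' x : E `<=` E' -> component E x `<=` component E' x.
Proof.
move=> EE'; apply: component_closed => [|u v xu _ /EE' uv].
  exact: component_refl.
exact: component_trans xu (component_edge uv).
Qed.

Lemma component_ge_mono E E' x :
  E `<=` E' -> component_ge E x -> component_ge E' x.
Proof.
by move=> EE' h; apply: card_le_trans h _; apply: subset_card_le; exact: component_mono.
Qed.

Lemma component_ge_eq E x y :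
  component E x y -> component_ge E x -> component_ge E y.
Proof. by rewrite /component_ge => /component_eq ->. Qed.

(** If [z] is connected to neither [x] nor [y], the new edge does not reach its component. *)
Lemma component_ge_addN E x y z : component_ge E x -> component_ge E y ->
  component_ge (E `|` [set [set x; y]]) z -> component_ge E z.
Proof.
move=> sx sy sz.
have [/component_ge_eq|nx] := pselect (component E x z); first exact.
have [/component_ge_eq|ny] := pselect (component E y z); first exact.
apply: card_le_trans sz _; apply: subset_card_le; apply: component_closed.
  exact: component_refl.
move=> u v zu _ [uv|]; first exact: component_trans zu (component_edge uv).
by move=> /set2_eq[] [e _]; [case: nx|case: ny]; rewrite -e; exact: component_sym.
Qed.

Lemma component_infinite E x : infinite_set (component E x) -> component_ge E x.
Proof. exact: infinite_card_ge. Qed.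

Let wins_sat2 :=
  winning_position_sat2 component_size_geP component_ge_mono component_ge_addN.
Let wins_unsat := winning_position_unsat component_size_geP.

Lemma component_isolated_unsat G x : ~ component_ge (pedges G) x ->
  (forall u v, component (pedges G) x u -> ~ undetermined G [set u; v]) ->
  undetermined G !=set0 -> wins G.
Proof.
move=> nx iso; apply: (@wins_unsat G x) => E EH EG sx; apply: nx.
apply: card_le_trans sx _; apply: subset_card_le; apply: component_closed.
  exact: component_refl.
move=> u v xu _ Euv; apply: (component_trans xu (component_edge _)).
by apply: (extends_pedges EH EG Euv); exact: iso.
Qed.

(** A set of components rather than of indices: several [r j] may share a component, and the two
    sides are to be separated by whole components. *)
Definition unsat_components G (r : nat -> H) : set (set H) :=
  [set component (pedges G) (r j) | j in
    [set j | m <= j /\ ~ component_ge (pedges G) (r j)]].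

Definition inside G (X : set H) (r : nat -> H) : set nat :=
  [set j | [/\ m <= j, X (r j) & component (pedges G) (r j) `<=` X]].

Definition touching G (Z : set H) (r : nat -> H) : set nat :=
  [set j | exists2 c, Z c & component (pedges G) (r j) c].

(** Unsatisfied components are finite, so finitely many of them would contain only finitely many
    [r j]. *)
Lemma unsat_components_infinite G (r : nat -> H) : injective r ->
  finite_set [set j | m <= j /\ component_ge (pedges G) (r j)] ->
  infinite_set (unsat_components G r).
Proof.
move=> injr fins finU.
pose J := [set j | m <= j /\ ~ component_ge (pedges G) (r j)].
have finJ : finite_set (r @` J).
  apply: (@sub_finite_set _ _ (\bigcup_(C in unsat_components G r) C)).
    move=> _ [j Jj <-]; exists (component (pedges G) (r j)); first by exists j.
    exact: component_refl.
  apply: bigcup_finite => // _ [j [_ nj] <-]; apply: contrapT.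
  by move=> /component_infinite.
have {}finJ : finite_set J.
  apply: card_le_finite finJ; rewrite (card_le_eqr (inj_card_eq _))//.
  by move=> i j _ _ /injr.
apply: infinite_nat; apply: (@sub_finite_set _ _
  (`I_m `|` [set j | m <= j /\ component_ge (pedges G) (r j)] `|` J)).
  move=> j _; have [jm|mj] := ltnP j m; first by left; left.
  by have [s|ns] := pselect (component_ge (pedges G) (r j)); [left; right|right].
by rewrite !finite_setU; do !split => //; exact: finite_II.
Qed.

Lemma inside_unsat_components G (r : nat -> H) (T : set (set H)) :
  T `<=` unsat_components G r -> infinite_set T ->
  infinite_set (inside G (\bigcup_(C in T) C) r) /\
  forall j, inside G (\bigcup_(C in T) C) r j -> ~ component_ge (pedges G) (r j).
Proof.
move=> TU infT; split; last first.
  move=> j [_ [C TC Cj] _]; have [k [_ nk] eqC] := TU _ TC.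
  move=> sj; apply: nk; apply: component_ge_eq sj.
  by apply: component_sym; rewrite eqC.
move=> fin; apply: infT.
apply: sub_finite_set (finite_image (fun j => component (pedges G) (r j)) fin).
move=> C TC; have [j [mj _] eqC] := TU _ TC; exists j => //; split=> //.
  by exists C => //; rewrite -eqC; exact: component_refl.
by rewrite eqC => x Cx; exists C.
Qed.

Section Biclique.
Variables l r : nat -> H.
Hypothesis lrP : biclique l r.

(* The pairs [l i], [r i] serve as guards: an unsatisfied component has fewer
   than [m] vertices, hence it avoids one of them, which can be left
   undetermined while the fate of that component is settled. *)
Lemma component_probe d S (a : H) (b : nat -> H) :
  injective b -> (forall j, undetermined S [set a; b j]) ->
  (forall j, component_ge (pedges S) (b j)) ->
  (forall i, i < m -> ~ component (pedges S) a (l i) ->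
     ~ component (pedges S) a (r i) -> undetermined S [set l i; r i]) ->
  `I_(m - d) #<= component (pedges S) a -> wins S.
Proof.
have [injl injr lr _] := lrP.
elim: d S => [|d IH] S injb ub sb guard da.
  by apply: (wins_sat2 (ub 0)) => //; rewrite /component_ge -[m]subn0.
(* All pairs meeting the current component of [a], except the probes. *)
pose Q := [set e | (exists2 x, component (pedges S) a x & e x) /\
                   forall j, e <> [set a; b j]].
apply: (@winning_position_ask_all _ _ S Q) => G SG uG.
have EG : pedges S `<=` pedges G by case: SG.
have ubG j : undetermined G [set a; b j] by rewrite uG; split=> // -[_ /(_ j)].
have sbG j : component_ge (pedges G) (b j) by apply: component_ge_mono (sb j).
have guardG i : i < m -> ~ component (pedges G) a (l i) ->
    ~ component (pedges G) a (r i) -> undetermined G [set l i; r i].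
  move=> im nl nr; rewrite uG; split.
    by apply: guard => // h; [apply: nl|apply: nr]; apply: component_mono h.
  by case=> -[x /(component_mono EG) ax] [] /= ex _; [apply: nl|apply: nr];
    rewrite -ex.
have [sa|nsa] := pselect (component_ge (pedges G) a); first exact: (wins_sat2 (ubG 0)).
(* If the component of [a] grew, [d] drops. Otherwise the probes decide: a positive answer merges it
   with a satisfied component, and negative answers throughout isolate it. *)
have [[y [aGy naSy]]|same] := pselect (exists y,
    component (pedges G) a y /\ ~ component (pedges S) a y).
  apply: IH => //.
  have : `I_(m - d.+1).+1 #<= component (pedges G) a.
    by apply: (card_ge_addl (b := y)) da _ _ _ => //; exact: component_mono.
  by apply: card_le_trans; rewrite card_le_II; lia.
have {}same u : component (pedges G) a u -> component (pedges S) a u.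
  by move=> au; apply: contrapT => nau; apply: same; exists u.
apply: (@winning_position_probe _ _ G (fun j => [set a; b j])) => //.
- by move=> i j /set2_injr/injb.
- move=> G' k GG' Gk uG'.
  have EG' : pedges G `<=` pedges G' by case: GG'.
  apply: (@wins_sat2 G' a (b k.+1)).
  + rewrite uG'; split=> // -[i /= ik /set2_injr/injb]; lia.
  + apply: (@component_ge_eq _ (b k)).
      by apply: component_edge; rewrite setUC.
    exact: component_ge_mono (sbG k).
  + exact: component_ge_mono (sbG _).
- move=> G' GG' eqE uG'; apply: (@component_isolated_unsat G' a).
  + by rewrite eqE.
  + move=> u v; rewrite eqE uG' uG => /same au [[uv nQ] nr].
    apply: nQ; split; first by exists u => //; left.
    by move=> j eqj; apply: nr; exists j.
  + have [i [im nl nr]] := card_lt_pigeonhole injl injr lr nsa.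
    exists [set l i; r i]; rewrite uG'; split; first exact: guardG.
    move=> [j _ /set2_eq[] [ea _]]; [apply: nl|apply: nr]; rewrite -ea;
      exact: component_refl.
Qed.

(** * One side of the biclique; used again with the sides exchanged *)

Section Half.
Variables (G1 G2 : pregraph H) (Z X X' : set H).
Hypotheses (m_gt0 : 0 < m) (finZ : finite_set Z).
Hypotheses (Zl : forall i, i < m -> Z (l i)) (Zr : forall i, i < m -> Z (r i)).
Hypothesis NZr : forall j, m <= j -> ~ Z (r j).
Hypothesis uG1 : forall e, edges H e ->
  (undetermined G1 e <-> exists2 x, Z x & e x).

Lemma component_many_sat :
  infinite_set [set j | m <= j /\ component_ge (pedges G1) (r j)] -> wins G1.
Proof.
have [injl injr lr lrE] := lrP.
move=> /infinite_set_inj[b injb /all_and2[_ sb]].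
apply: (@component_probe m G1 (l 0) (r \o b)) => //.
- exact: inj_comp.
- by move=> j; apply/(uG1 (lrE _ _)); exists (l 0); [exact: Zl|left].
- by move=> i im _ _; apply/(uG1 (lrE _ _)); exists (l i); [exact: Zl|left].
- by rewrite subnn II0; exact: card_ge0.
Qed.

(* [X] and [X'] are unions of components of [G1]. After the second round, a
   vertex of [Z] other than [l 0] has no undetermined pair with [X]. *)
Definition link (c0 : H) (A : set H) : set (set H) :=
  [set e | exists c x, [/\ e = [set c; x], Z c, c <> c0 & A x]].

Hypothesis NZX : forall x, X x -> ~ Z x.
Hypothesis NZX' : forall x, X' x -> ~ Z x.
Hypothesis XX' : X `&` X' = set0.
Hypothesis G12 : pext G1 G2.
Hypothesis uG2 : undetermined G2 =
  undetermined G1 `\` (link (l 0) X `|` link (r 0) X').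

Let J := inside G1 X r.
Let touched := touching G2 Z r.

(** As [Z] is finite, some [c] in [Z] is connected to infinitely many [r j]. These share an infinite
    component, so they are satisfied and can serve as probes from [l 0]. *)
Lemma component_many_touched : infinite_set (J `&` touched) -> wins G2.
Proof.
have [injl injr lr lrE] := lrP; move=> infJ.
have [c Zc infc] : exists2 c, Z c &
    infinite_set [set j | J j /\ component (pedges G2) (r j) c].
  apply: contrapT => nex; apply: infJ.
  apply: (@sub_finite_set _ _
    (\bigcup_(c in Z) [set j | J j /\ component (pedges G2) (r j) c])).
    by move=> j [Jj [c Zc jc]]; exists c.
  apply: bigcup_finite => // c Zc; apply: contrapT => infc.
  by apply: nex; exists c.
have [b injb bP] := infinite_set_inj infc.
have sc : component_ge (pedges G2) c.
  apply: component_infinite => fin.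
  apply: (range_inj_infinite (inj_comp injr injb)); apply: sub_finite_set fin.
  by move=> _ [j _ <-]; apply: component_sym; case: (bP j).
apply: (@component_probe m G2 (l 0) (r \o b)) => //.
- exact: inj_comp.
(* This pair survives the second round: its center [l 0] is the one exempted for [X], and [r (b j)]
   lies in [X], which is disjoint from [X']. *)
- move=> j; have [[mj Xj _] _] := bP j; rewrite uG2; split.
    by apply/(uG1 (lrE _ _)); exists (l 0); [exact: Zl|left].
  case=> -[d [x []]] /set2_eq[] [e1 e2] Zd nd Ax.
  + by apply: nd.
  + by move: e2 Zd => /= <- /(NZr mj).
  + have : (X `&` X') x by split=> //; rewrite -e2.
    by rewrite XX'.
  + by move: e2 Zd => /= <- /(NZr mj).
- move=> j; apply: component_ge_eq sc; apply: component_sym.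
  by case: (bP j).
- move=> i im _ _; rewrite uG2; split.
    by apply/(uG1 (lrE _ _)); exists (l i); [exact: Zl|left].
  have [Zli Zri] := (Zl im, Zr im).
  by case=> -[d [x []]] /set2_eq[] [e1 e2] Zd nd Ax;
    [apply: (NZX Ax)|apply: (NZX Ax)|apply: (NZX' Ax)|apply: (NZX' Ax)];
    rewrite -?e1 -?e2.
- by rewrite subnn II0; exact: card_ge0.
Qed.

(** An untouched component inside [X] can leave its [G1]-boundary only through [l 0]. Failing that,
    it stays unsatisfied and misses [r 0], against the last hypothesis. So infinitely many [r j] are
    connected to [l 0]. *)
Lemma component_forced G3 : infinite_set (J `\` touched) ->
  (forall j, J j -> ~ component_ge (pedges G1) (r j)) ->
  pext G2 G3 ->
  (forall z, [\/ component_ge (pedges G3) z, component (pedges G3) z (l 0) |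
                 component (pedges G3) z (r 0)]) ->
  component_ge (pedges G3) (l 0).
Proof.
have [injl injr lr lrE] := lrP; move=> infJ nsat G23 sat3.
have G13 := pext_trans G12 G23.
have E13 : pedges G1 `<=` pedges G3 by case: G13.
apply: component_infinite => fin; apply: infJ.
apply: (@card_le_finite _ _ _ (r @` (J `\` touched))).
  by rewrite (card_le_eqr (inj_card_eq _))// => i j _ _ /injr.
apply: sub_finite_set fin => _ [j [Jj ntj] <-].
apply: contrapT => nlj; have {}nlj : ~ component (pedges G3) (r j) (l 0).
  by move=> /component_sym.
have [mj Xj CX] := Jj.
have sub : component (pedges G3) (r j) `<=` component (pedges G1) (r j).
  apply: component_closed; first exact: component_refl.
  move=> u v ju ju3 uv3.
  have [u1|nu1] := pselect (undetermined G1 [set u; v]); last first.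
    apply: (component_trans ju (component_edge _)).
    exact: (pedges_old G13 uv3).
  have nZu : ~ Z u by apply: NZX; exact: CX.
  (* Pairs undetermined in [G1] meet [Z], and [u] lies outside [Z]. If [v] is not [l 0], the pair
     was settled by the second round, so [j] would be touched. *)
  have Zv : Z v.
    have [x Zx [] /= ex] := (uG1 (pedges_edges uv3)).1 u1; last by rewrite -ex.
    by case: nZu; rewrite -ex.
  have [vl|vl] := pselect (v = l 0).
    by case: nlj; rewrite -vl; exact: component_trans ju3 (component_edge uv3).
  case: ntj; exists v => //.
  apply: (@component_trans _ u).
    by apply: component_mono ju; case: G12.
  apply: component_edge; apply: (pedges_old G23 uv3).
  rewrite uG2 => -[_]; apply; left; exists v, u; split=> //; first by rewrite setUC.
  exact: CX.
have [s|//|] := sat3 (r j).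
  apply: (nsat _ Jj); apply: card_le_trans s _; exact: subset_card_le.
by move=> /sub/CX/NZX; apply; exact: Zr.
Qed.

End Half.
End Biclique.

Lemma component_size_not_elusive (l r : nat -> H) : 0 < m ->
  biclique l r -> alice_has_winning_strategy H (component_size_ge m).
Proof.
move=> m_gt0 lrP; have rlP := biclique_sym lrP.
have [injl injr lr lrE] := lrP.
have [S [ES NS]] := empty_pregraph H.
apply: (winning_position_start ES NS).
have uS : undetermined S = edges H.
  by rewrite /undetermined /determined ES NS setU0 setD0.
pose Z := (l @` `I_m) `|` (r @` `I_m).
have Zl i : i < m -> Z (l i) by left; exists i.
have Zr i : i < m -> Z (r i) by right; exists i.
have NZl j : m <= j -> ~ Z (l j).
  move=> mj [[i /= im /injl]|[i _ /esym/lr//]]; lia.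
have NZr j : m <= j -> ~ Z (r j).
  move=> mj [[i _ /lr//]|[i /= im /injr]]; lia.
have finZ : finite_set Z.
  by rewrite /Z finite_setU; split; apply: finite_image; exact: finite_II.
apply: (@winning_position_ask_all _ _ S
  [set e | forall x, Z x -> ~ e x]) => G1 _ uG.
have uG1 e : edges H e -> (undetermined G1 e <-> exists2 x, Z x & e x).
  move=> eH; rewrite uG uS; split=> [[_ /existsNP[x /not_implyP[Zx /contrapT]]]|].
    by exists x.
  by move=> [x Zx ex]; split=> // /(_ x Zx).
(* Every pair at [Z] is still undetermined in [G1], so no edge enters [Z]. *)
have NZcomp x : ~ Z x -> component (pedges G1) x `<=` ~` Z.
  move=> nZx; apply: component_closed => // u v _ _ uv Zv.
  have [_] : undetermined G1 [set u; v]; last by apply; left.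
  by apply/(uG1 _ (pedges_edges uv)); exists v => //; right.
have [finr|/(component_many_sat lrP m_gt0 Zl uG1)//] :=
  pselect (finite_set [set j | m <= j /\ component_ge (pedges G1) (r j)]).
have [finl|/(component_many_sat rlP m_gt0 Zr uG1)//] :=
  pselect (finite_set [set j | m <= j /\ component_ge (pedges G1) (l j)]).
(* One component may meet both sides of the biclique; disjoint families reserve each chosen
   component for one center. *)
have [T [T' [TU TU' infT infT' TT']]] := infinite_split
  (unsat_components_infinite injr finr) (unsat_components_infinite injl finl).
have [infJ nsat] := inside_unsat_components TU infT.
have [infJ' nsat'] := inside_unsat_components TU' infT'.
set X := \bigcup_(C in T) C in infJ nsat.
set X' := \bigcup_(C in T') C in infJ' nsat'.
have NZX x : X x -> ~ Z x.
  move=> [C /TU[j [mj _] <-]]; apply: NZcomp; exact: NZr.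
have NZX' x : X' x -> ~ Z x.
  move=> [C /TU'[j [mj _] <-]]; apply: NZcomp; exact: NZl.
have XX' : X `&` X' = set0.
  apply/seteqP; split=> // x [[C TC Cx] [C' TC' Cx']].
  have [j _ eqC] := TU _ TC; have [k _ eqC'] := TU' _ TC'.
  suff : (T `&` T') C by rewrite TT'.
  split=> //; suff -> : C = C' by [].
  move: Cx Cx'; rewrite -eqC -eqC' => /component_eq -> /component_eq ->//.
(* The second round cuts [X] off from all centers but [l 0], and [X'] from all but [r 0], unless
   Bob's edges make components touch [Z]. *)
apply: (@winning_position_ask_all _ _ G1
  (link Z (l 0) X `|` link Z (r 0) X')) => G2 G12 uG2.
have uG2' : undetermined G2 =
    undetermined G1 `\` (link Z (r 0) X' `|` link Z (l 0) X).
  by rewrite uG2 [link _ _ _ `|` _]setUC.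
have X'X : X' `&` X = set0 by rewrite setIC.
have [fint|/(component_many_touched lrP m_gt0 finZ Zl Zr NZr uG1 NZX NZX' XX' uG2)//] :=
  pselect (finite_set (inside G1 X r `&` touching G2 Z r)).
have [fint'|/(component_many_touched rlP m_gt0 finZ Zr Zl NZl uG1 NZX' NZX X'X uG2')//] :=
  pselect (finite_set (inside G1 X' l `&` touching G2 Z l)).
have {}infJ : infinite_set (inside G1 X r `\` touching G2 Z r).
  exact: infinite_setDI.
have {}infJ' : infinite_set (inside G1 X' l `\` touching G2 Z l).
  exact: infinite_setDI.
apply: (@winning_position_ask_all _ _ G2 (~` [set [set l 0; r 0]])).
move=> G3 G23 uG3.
have {}uG3 : undetermined G3 = [set [set l 0; r 0]].
  rewrite uG3 setDE setCK setIC; apply: setIidl => _ ->; rewrite uG2.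
  split; first by apply/(uG1 _ (lrE _ _)); exists (l 0); [exact: Zl|left].
  have [Zl0 Zr0] := (Zl _ m_gt0, Zr _ m_gt0).
  by case=> -[d [x []]] /set2_eq[] [e1 e2] Zd nd Ax;
    [apply: (NZX _ Ax)|apply: (NZX _ Ax)|apply: (NZX' _ Ax)|apply: (NZX' _ Ax)];
    rewrite -?e1 -?e2.
have [sat3|] := pselect (forall z, [\/ component_ge (pedges G3) z,
    component (pedges G3) z (l 0) | component (pedges G3) z (r 0)]).
  apply: (@wins_sat2 G3 (l 0) (r 0)); first by rewrite uG3.
    exact: (component_forced lrP m_gt0 Zr uG1 NZX G12 uG2 infJ nsat G23 sat3).
  apply: (component_forced rlP m_gt0 Zl uG1 NZX' G12 uG2' infJ' nsat' G23).
  by move=> z; case: (sat3 z) => ?; [constructor 1|constructor 3|constructor 2].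
(* The component of [z] avoids both ends of the last pair, so it can no longer grow. *)
move=> /existsNP[z nz]; apply: (@component_isolated_unsat G3 z).
- by move=> sz; apply: nz; constructor 1.
- move=> u v zu; rewrite uG3 => /set2_eq[] [eu _]; apply: nz; rewrite -eu.
    by constructor 2.
  by constructor 3.
- by exists [set l 0; r 0]; rewrite uG3.
Qed.

End Component.

(** * Bicliques in the three kinds of graphs *)

Lemma complete_graph_biclique (K : Type) : infinite_set [set: K] ->
  exists l r : nat -> complete_graph K, biclique l r.
Proof.
move=> /infinite_set_inj[f injf _].
exists (fun i => f i.*2), (fun j => f j.*2.+1).
have lr i j : f i.*2 <> f j.*2.+1 by move=> /injf; lia.
split=> // [i j /injf/double_inj//|i j /injf[]/double_inj//|i j].
by exists (f i.*2), (f j.*2.+1).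
Qed.

Lemma turan_graph_biclique (K : Type) k : infinite_set [set: K] -> 2 <= k ->
  exists l r : nat -> turan_graph K k, biclique l r.
Proof.
move=> /infinite_set_inj[f injf _] k2.
pose o0 := Ordinal (ltnW k2); pose o1 := Ordinal k2.
exists (fun i => (f i, o0)), (fun j => (f j, o1)).
split=> // [i j [/injf]//|i j [/injf]//|i j].
by exists (f i, o0), (f j, o1).
Qed.

(** The constant [false] sequences form a chain of prefixes, hence an infinite clique, which is
    split by parity of length. *)
Lemma cantor_graph_biclique : exists l r : nat -> cantor_graph, biclique l r.
Proof.
have inj i j : nseq i false = nseq j false -> i = j.
  by move=> /(congr1 size); rewrite !size_nseq.
have prefix_nseq i j : i <= j -> prefix (nseq i false) (nseq j false).
  by move=> ij; rewrite -(subnKC ij) nseqD prefix_prefix.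
exists (fun i => nseq i.*2 false), (fun j => nseq j.*2.+1 false).
have lr i j : nseq i.*2 false <> nseq j.*2.+1 false by move=> /inj; lia.
split=> // [i j /inj/double_inj//|i j /inj[]/double_inj//|i j].
exists (nseq i.*2 false), (nseq j.*2.+1 false); split=> //.
have ne : nseq i.*2 false != nseq j.*2.+1 false by apply/eqP; exact: lr.
rewrite /proper_prefix.
have [/ltnW/prefix_nseq ij|/ltnW/prefix_nseq ji|/(congr1 (nseq^~ false))/lr//] :=
  ltngtP i.*2 j.*2.+1; first by left; rewrite ij.
by right; rewrite ji eq_sym.
Qed.

Theorem theorem3p8 (H : graph) (P : graph_property)
  (hP : (exists n : nat, 1 <= n /\ P = min_degree_ge n) \/
        (exists m : nat, 2 <= m /\ P = component_size_ge m))
  (hH : (exists K : Type, infinite_set [set: K] /\ H = complete_graph K) \/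
        (exists (K : Type) (k : nat),
           [/\ infinite_set [set: K], 2 <= k & H = turan_graph K k]) \/
        H = cantor_graph) :
  alice_has_winning_strategy H P /\ ~ elusive H P.
Proof.
suff win : alice_has_winning_strategy H P by split=> // /(_ win).
have [l [r lrP]] : exists l r : nat -> H, biclique l r.
  case: hH => [[K [infK ->]]|[[K [k [infK k2 ->]]]|->]].
  - exact: complete_graph_biclique.
  - exact: turan_graph_biclique.
  - exact: cantor_graph_biclique.
case: hP => [[n [_ ->]]|[m [m2 ->]]]; first exact: min_degree_not_elusive lrP.
by apply: component_size_not_elusive lrP; exact: ltnW.
Qed.
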